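(* Let $\tau>0$ and let $\mathbf d=(\mathbf a,\mathbf b)\in\mathbb Z^{N\times 2}$ range over a sequence of bidegree sequences with $\sum_n a_n=\sum_n b_n+1$ and $\max_i\max(a_i,b_i)=O(S^{\frac12-\tau})$. For indices $i,j$ with $a_i,a_j\ge1$ let $\mathbf d_{-i}=(\mathbf a-\mathbf e_i,\mathbf b)$, $\mathbf d_{-j}=(\mathbf a-\mathbf e_j,\mathbf b)$. Then $$\frac{\|G_{\mathbf d_{-i}}\|}{\|G_{\mathbf d_{-j}}\|}=\frac{a_i}{a_j}\,e^{(a_i-a_j)\epsilon+O(S^{-4\tau})},\qquad \epsilon=\frac{\beta_2-\beta_1}{\beta_1^2},$$ and moreover $(a_i-a_j)\epsilon=O(S^{-2\tau})$.
   Context: $\|G_{\mathbf d}\|$ is the number of directed graphs on $\{1,\dots,N\}$ (each ordered pair, including loops, carrying at most one edge) with in-degree sequence $\mathbf a$ and out-degree sequence $\mathbf b$; equivalently the number of $N\times N$ $0$-$1$ matrices with row sums $\mathbf a$ and column sums $\mathbf b$. $\beta_k=\sum_{n=1}^N b_n^k$. $S$ is the number of edges. $O(\cdot)$ is with respect to $S\to\infty$ along the sequence, with constants uniform in the indices. *)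

(* Defs.v *)
From mathcomp Require Import all_boot all_order all_algebra.
From mathcomp Require Import all_classical all_reals all_analysis.

Set Implicit Arguments.
Unset Strict Implicit.
Unset Printing Implicit Defensive.

Import Order.TTheory GRing.Theory Num.Theory.
Import numFieldNormedType.Exports.

Local Open Scope ring_scope.

(* A directed graph on 'I_N, with loops allowed and at most one edge per ordered
   pair, is a set E of ordered pairs; (m, n) \in E is the edge m -> n. *)
Definition indeg (N : nat) (E : {set 'I_N * 'I_N}) (n : 'I_N) : nat :=
  #|[set m | (m, n) \in E]|.

Definition outdeg (N : nat) (E : {set 'I_N * 'I_N}) (n : 'I_N) : nat :=
  #|[set m | (n, m) \in E]|.

Definition digraphs (N : nat) (a b : 'I_N -> nat) : {set {set 'I_N * 'I_N}} :=
  [set E | [forall n, (indeg E n == a n) && (outdeg E n == b n)]].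

(* a - e_i; the subtraction is truncated, so this is meaningful only when
   a i >= 1. *)
Definition decr (N : nat) (a : 'I_N -> nat) (i : 'I_N) : 'I_N -> nat :=
  fun n => (a n - (n == i))%N.

Definition beta (N : nat) (b : 'I_N -> nat) (k : nat) : nat :=
  (\sum_(n < N) b n ^ k)%N.

Definition maxdeg (N : nat) (a b : 'I_N -> nat) : nat :=
  (\max_(n < N) maxn (a n) (b n))%N.

(* The out-degrees sum to the number of edges.  When \sum a = \sum b + 1, this
   is the number of edges of every graph in digraphs (decr a i) b, a i >= 1. *)
Definition edges (N : nat) (b : 'I_N -> nat) : nat := (\sum_(n < N) b n)%N.

Definition epsilon (R : realType) (N : nat) (b : 'I_N -> nat) : R :=
  ((beta b 2)%:R - (beta b 1)%:R) / (beta b 1)%:R ^+ 2.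

(* Main.v *)
Require Import Defs.
From mathcomp Require Import all_boot all_order all_algebra.
From mathcomp Require Import all_classical all_reals all_analysis.
From mathcomp Require Import zify ring lra.

Set Implicit Arguments.
Unset Strict Implicit.
Unset Printing Implicit Defensive.

(* Write p = a_i, q = a_j, let d be the maximal degree and c(E) the number of
   common in-neighbours of i and j in E.  Moving one edge (n, i) to (n, j) gives
   |G_{d_-j}| (p - E[c]) = |G_{d_-i}| (q - E[c]), each mean being over the graphs
   counted next to it.  To compute E[c], trade the pair (n, i), (n, j) and two
   arbitrary edges (m1, k1), (m2, k2) for (n, k1), (n, k2), (m1, i), (m2, j):
   a pair can be switched away in S^2 (1 + O(d^2/S)) ways, and a graph is reached
   in a_i a_j (beta_2 - beta_1) + O(a_i a_j d^3) ways, so that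
   E[c] = a_i a_j (epsilon + O(d^3/S^2)) with the in-degrees of the graphs under
   consideration.  Hence the ratio is (p/q) (1 - X)/(1 - Y) with
   X = (q - 1) epsilon + O(d^4/S^2) and Y = (p - 1) epsilon + O(d^4/S^2). *)

(** * Switchings: replacing one list of edges by another *)

Section Swap.
Variable T : finType.
Implicit Types (E : {set T}) (s t : seq T).

(** Lists let concrete switchings, and sums over their edges, unfold directly; repetitions are lost
    here, hence the [uniq] hypotheses in the counts. *)
Definition swap E s t : {set T} := (E :\: [set e in s]) :|: [set e in t].

Definition fits s t E := all (mem E) s && all (mem (~: E)) t.

Lemma fitsP s t E :
  reflect ({in s, forall e, e \in E} /\ {in t, forall e, e \notin E}) (fits s t E).
Proof.
apply: (iffP andP) => [[/allP sE /allP tE]|[sE tE]]; split.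
- exact: sE.
- by move=> e /tE; rewrite /= inE.
- by apply/allP => e /sE.
- by apply/allP => e /tE; rewrite /= inE.
Qed.

Lemma fits_swap s t E : fits s t E -> fits t s (swap E s t).
Proof.
move=> /fitsP[sE tE]; apply/fitsP; split=> e he; rewrite !inE ?he ?orbT //=.
by apply/negP => /tE; rewrite sE.
Qed.

Lemma swapK s t E : fits s t E -> swap (swap E s t) t s = E.
Proof.
move=> /fitsP[sE tE]; apply/setP => e; rewrite !inE.
case: (boolP (e \in s)) => [/sE ->|_]; first by rewrite orbT.
by case: (boolP (e \in t)) => [/tE/negbTE ->|_] //=; rewrite !orbF.
Qed.

(** Both sides are the sum over the edges of [E] outside [s], plus those over [s] and [t].
    Indicators of an endpoint give degrees, [f = 1] gives the number of edges. *)
Lemma sum_swap (f : T -> nat) s t E : uniq s -> uniq t -> fits s t E ->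
  \sum_(e in swap E s t) f e + \sum_(e <- s) f e
  = \sum_(e in E) f e + \sum_(e <- t) f e.
Proof.
move=> us ut /fitsP[sE tE].
have sumE r : uniq r -> \sum_(e <- r) f e = \sum_(e in [set e in r]) f e.
  by move=> ur; rewrite big_uniq //=; apply: eq_bigl => e; rewrite inE.
rewrite !sumE // (big_setID [set e in t]) /= [in RHS](big_setID [set e in s]) /=.
have -> : swap E s t :&: [set e in t] = [set e in t].
  by apply/setP => e; rewrite !inE andbC; case: (e \in t); rewrite ?orbT.
have -> : swap E s t :\: [set e in t] = E :\: [set e in s].
  apply/setP => e; rewrite !inE; case: (boolP (e \in t)) => [/tE/negbTE ->|_].
    by rewrite andbF.
  by rewrite orbF.
have -> : E :&: [set e in s] = [set e in s].
  by apply/setP => e; rewrite !inE; apply/andP/idP => [[]//|es]; rewrite sE.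
by rewrite [LHS]addnC addnA [RHS]addnAC.
Qed.

(** Swapping back undoes a fitting swap, so each side injects into the other. *)
Lemma card_fits (A B : {set {set T}}) s t :
  {in A, forall E, fits s t E -> swap E s t \in B} ->
  {in B, forall E, fits t s E -> swap E t s \in A} ->
  #|[set E in A | fits s t E]| = #|[set E in B | fits t s E]|.
Proof.
have le (C D : {set {set T}}) u v : {in C, forall E, fits u v E -> swap E u v \in D} ->
    #|[set E in C | fits u v E]| <= #|[set E in D | fits v u E]|.
  move=> CD; rewrite -(@card_in_imset _ _ (fun E => swap E u v)).
    apply/subset_leq_card/fintype.subsetP => _ /imsetP[E + ->].
    by rewrite !inE => /andP[EC fE]; rewrite CD //= fits_swap.
  move=> E F; rewrite !inE => /andP[_ fE] /andP[_ fF] /(congr1 (fun G => swap G v u)).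
  by rewrite !swapK.
by move=> AB BA; apply/eqP; rewrite eqn_leq !le.
Qed.

End Swap.

(** * Degrees under switchings, and the move of a single edge *)

Section Degrees.
Variable N : nat.
Implicit Types (E : {set 'I_N * 'I_N}) (s t : seq ('I_N * 'I_N)).

Lemma indeg_sum E v : indeg E v = \sum_n ((n, v) \in E).
Proof. by rewrite /indeg -sum1dep_card big_mkcond; apply: eq_bigr => n _; case: ifP. Qed.

Lemma outdeg_sum E v : outdeg E v = \sum_n ((v, n) \in E).
Proof. by rewrite /outdeg -sum1dep_card big_mkcond; apply: eq_bigr => n _; case: ifP. Qed.

Lemma indegE E v : indeg E v = \sum_(e in E) (e.2 == v).
Proof.
rewrite indeg_sum (eq_bigr (fun n => \sum_k ((n, k) \in E) * (k == v))); last first.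
  move=> n _; rewrite (bigD1 v) //= eqxx muln1 big1 ?addn0 // => k /negbTE ->.
  by rewrite muln0.
rewrite pair_big [RHS]big_mkcond; apply: eq_bigr => -[n k] _ /=.
by case: ifP => _; rewrite ?mul1n.
Qed.

Lemma outdegE E v : outdeg E v = \sum_(e in E) (e.1 == v).
Proof.
rewrite outdeg_sum (eq_bigr (fun n => \sum_k ((k, n) \in E) * (k == v))); last first.
  move=> n _; rewrite (bigD1 v) //= eqxx muln1 big1 ?addn0 // => k /negbTE ->.
  by rewrite muln0.
rewrite exchange_big pair_big [RHS]big_mkcond; apply: eq_bigr => -[n k] _ /=.
by case: ifP => _; rewrite ?mul1n.
Qed.

Lemma indeg_swap s t E v : uniq s -> uniq t -> fits s t E ->
  indeg (swap E s t) v + \sum_(e <- s) (e.2 == v)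
  = indeg E v + \sum_(e <- t) (e.2 == v).
Proof. by rewrite !indegE; exact: sum_swap. Qed.

Lemma outdeg_swap s t E v : uniq s -> uniq t -> fits s t E ->
  outdeg (swap E s t) v + \sum_(e <- s) (e.1 == v)
  = outdeg E v + \sum_(e <- t) (e.1 == v).
Proof. by rewrite !outdegE; exact: sum_swap. Qed.

Lemma digraphsP (a b : 'I_N -> nat) E :
  reflect (indeg E =1 a /\ outdeg E =1 b) (E \in digraphs a b).
Proof.
rewrite inE; apply: (iffP forallP) => [h|[ha hb] n]; last by rewrite ha hb !eqxx.
by split=> n; have /andP[/eqP ? /eqP ?] := h n.
Qed.

Definition codeg E (i j : 'I_N) := \sum_n ((n, i) \in E) * ((n, j) \in E).

Lemma card_sum_fits (A : {set {set 'I_N * 'I_N}}) s t :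
  \sum_(E in A) fits s t E = #|[set E in A | fits s t E]|.
Proof.
rewrite -sum1_card [RHS]big_mkcond [LHS]big_mkcond; apply: eq_bigr => E _.
by rewrite inE; case: ifP => //= _; case: ifP.
Qed.

(* Moving the edge (n, i) to (n, j) maps digraphs (decr a j) b to
   digraphs (decr a i) b. *)
Lemma sum_codeg_move (a b : 'I_N -> nat) (i j : 'I_N) : i != j ->
  0 < a i -> 0 < a j ->
  #|digraphs (decr a j) b| * a i + \sum_(E in digraphs (decr a i) b) codeg E i j
  = #|digraphs (decr a i) b| * a j + \sum_(E in digraphs (decr a j) b) codeg E i j.
Proof.
move=> ij ai aj.
(* Lowering the in-degree of [l] leaves that of [k] alone; an edge [(n, k)] either starts at a
   common in-neighbour or can be moved to [(n, l)]. *)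
have half (k l : 'I_N) : k != l -> #|digraphs (decr a l) b| * a k =
    \sum_(E in digraphs (decr a l) b) codeg E k l +
    \sum_n \sum_(E in digraphs (decr a l) b) fits [:: (n, k)] [:: (n, l)] E.
  move=> kl; rewrite [X in _ + X]exchange_big -big_split -[LHS]sum_nat_const /=; apply: eq_bigr.
  move=> E /digraphsP[/(_ k) + _]; rewrite indeg_sum /decr (negbTE kl) subn0 => <-.
  rewrite -big_split; apply: eq_bigr => n _.
  by rewrite /fits /= inE; do 2!case: (_ \in E).
have codegC : \sum_(E in digraphs (decr a i) b) codeg E i j =
    \sum_(E in digraphs (decr a i) b) codeg E j i.
  by apply: eq_bigr => E _; apply: eq_bigr => n _; rewrite mulnC.
have move_mem (k l : 'I_N) n : k != l -> 0 < a k -> 0 < a l ->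
    {in digraphs (decr a l) b, forall E, fits [:: (n, k)] [:: (n, l)] E ->
    swap E [:: (n, k)] [:: (n, l)] \in digraphs (decr a k) b}.
  move=> kl ak al E /digraphsP[inE' outE'] fE; apply/digraphsP; split=> v.
    have := @indeg_swap [:: (n, k)] [:: (n, l)] E v isT isT fE.
    rewrite !big_seq1 inE' /decr /= ![_ == v]eq_sym.
    case: (v =P k) => [->|_]; first by rewrite (negbTE kl); lia.
    by case: (v =P l) => [->|_]; lia.
  have := @outdeg_swap [:: (n, k)] [:: (n, l)] E v isT isT fE.
  by rewrite !big_seq1 outE' /=; lia.
rewrite (half i j) // (half j i) 1?eq_sym // codegC.
have -> : \sum_n \sum_(E in digraphs (decr a j) b) fits [:: (n, i)] [:: (n, j)] E =
    \sum_n \sum_(E in digraphs (decr a i) b) fits [:: (n, j)] [:: (n, i)] E.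
  apply: eq_bigr => n _; rewrite !card_sum_fits; apply: card_fits; apply: move_mem => //.
  by rewrite eq_sym.
lia.
Qed.

End Degrees.

(** * Double switchings, and how many of them a fixed graph admits *)

Lemma sum_mulr_leq (I : finType) (f g : I -> nat) c : (forall k, g k <= c) ->
  \sum_k f k * g k <= (\sum_k f k) * c.
Proof. by move=> gc; rewrite big_distrl; apply: leq_sum => k _; rewrite leq_mul2l gc orbT. Qed.

Lemma sum_pair_mul (I J : finType) (f : I -> nat) (g : J -> nat) :
  \sum_(p : I * J) f p.1 * g p.2 = (\sum_k f k) * (\sum_k g k).
Proof. by rewrite big_distrlr pair_big. Qed.

Section DoubleSwitch.
Variable N : nat.
Implicit Types (E : {set 'I_N * 'I_N}) (p q : 'I_N * 'I_N).

Lemma swap_digraphs (a b : 'I_N -> nat) s t E : uniq s -> uniq t -> fits s t E ->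
  (forall v, \sum_(e <- s) (e.1 == v) = \sum_(e <- t) (e.1 == v)) ->
  (forall v, \sum_(e <- s) (e.2 == v) = \sum_(e <- t) (e.2 == v)) ->
  E \in digraphs a b -> swap E s t \in digraphs a b.
Proof.
move=> us ut fE eq1 eq2 /digraphsP[inE' outE']; apply/digraphsP; split=> v.
  by have := indeg_swap v us ut fE; rewrite eq2 inE' => /addIn.
by have := outdeg_swap v us ut fE; rewrite eq1 outE' => /addIn.
Qed.

(* The lists of edges removed and added by the double switching: p and q are the
   two auxiliary edges. *)
Definition sw_old (i j n : 'I_N) p q := [:: (n, i); (n, j); p; q].
Definition sw_new (i j n : 'I_N) p q := [:: (n, p.2); (n, q.2); (p.1, i); (q.1, j)].

(** For fixed [n], [p], [q] the switching and its reverse preserve all degrees, so they match the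
    graphs they apply to. The condition [p.2 != q.2] keeps [(n, p.2)] and [(n, q.2)] distinct. *)
Lemma double_switch (a b : 'I_N -> nat) (i j : 'I_N) : i != j ->
  \sum_(E in digraphs a b) \sum_n \sum_p \sum_q
     (p.2 != q.2) * fits (sw_old i j n p q) (sw_new i j n p q) E
  = \sum_(E in digraphs a b) \sum_n \sum_p \sum_q
     (p.2 != q.2) * fits (sw_new i j n p q) (sw_old i j n p q) E.
Proof.
move=> ij.
rewrite [LHS]exchange_big [RHS]exchange_big; apply: eq_bigr => n _.
rewrite [LHS]exchange_big [RHS]exchange_big; apply: eq_bigr => -[p1 p2] _.
rewrite [LHS]exchange_big [RHS]exchange_big; apply: eq_bigr => -[q1 q2] _.
rewrite -!big_distrr; case: eqVneq => //= pq.
congr (_ * _); rewrite !card_sum_fits.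
set s := sw_old _ _ _ _ _; set t := sw_new _ _ _ _ _.
have us : n != p1 -> n != q1 -> uniq s && uniq t.
  move=> np nq; rewrite /s /t /sw_old /sw_new /= !inE !xpair_eqE !eqxx /=.
  by rewrite ?(negbTE np) ?(negbTE nq) ?(negbTE ij) ?(negbTE pq) ?andbF ?orbF.
(* A fitting switching has [n] distinct from [p1] and [q1]: of [(n, i)] and [(p1, i)] exactly one is
   an edge, and likewise for [(n, j)] and [(q1, j)]. *)
have neq E : ((n, i) \in E) != ((p1, i) \in E) ->
    ((n, j) \in E) != ((q1, j) \in E) ->
    uniq s && uniq t.
  by move=> ni nj; apply: us; [move: ni|move: nj]; apply: contraNneq => ->.
have eq1 v : \sum_(e <- s) (e.1 == v) = \sum_(e <- t) (e.1 == v).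
  by rewrite !big_cons !big_nil.
have eq2 v : \sum_(e <- s) (e.2 == v) = \sum_(e <- t) (e.2 == v).
  by rewrite !big_cons !big_nil /=; lia.
apply: card_fits => E EG fE.
  have /andP[us1 ut1] : uniq s && uniq t.
    have /fitsP[sE tE] := fE.
    by apply: (neq E); rewrite sE ?(negbTE (tE _ _)) // !inE eqxx ?orbT.
  exact: (swap_digraphs us1 ut1 fE eq1 eq2 EG).
have /andP[us1 ut1] : uniq s && uniq t.
  have /fitsP[tE sE] := fE.
  by apply: (neq E); rewrite (negbTE (sE _ _)) ?tE // !inE eqxx ?orbT.
exact: (swap_digraphs ut1 us1 fE (fsym eq1) (fsym eq2) EG).
Qed.

Section Counts.
Variables (E : {set 'I_N * 'I_N}) (a b : 'I_N -> nat) (d : nat).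
Hypothesis EG : E \in digraphs a b.
Hypotheses (ad : forall n, a n <= d) (bd : forall n, b n <= d).

Let x p : nat := p \in E.
Let S := \sum_n b n.

Let rowE n : \sum_k x (n, k) = b n.
Proof. by have /digraphsP[_ <-] := EG; rewrite outdeg_sum. Qed.

Let colE n : \sum_k x (k, n) = a n.
Proof. by have /digraphsP[<- _] := EG; rewrite indeg_sum. Qed.

Let edgesE : \sum_p x p = S.
Proof.
rewrite (eq_bigr (fun p => x (p.1, p.2))); last by case.
by rewrite -(pair_big predT predT (fun m k => x (m, k))) /=; apply: eq_bigr => n _.
Qed.

(** Such an edge leaves one of the [a i] in-neighbours of [i], each of out-degree at most [d]. *)
Lemma in_path i : \sum_p x p * x (p.1, i) <= a i * d.
Proof.
rewrite (eq_bigr (fun p => x (p.1, i) * x (p.1, p.2))); last first.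
  by move=> [? ?] _; rewrite mulnC.
rewrite -(pair_big predT predT (fun m k => x (m, i) * x (m, k))) /=.
under eq_bigr do rewrite -big_distrr /= rowE.
by rewrite -colE; exact: sum_mulr_leq.
Qed.

Lemma out_path n : \sum_p x p * x (n, p.2) <= b n * d.
Proof.
rewrite (eq_bigr (fun p => x (n, p.2) * x (p.1, p.2))); last first.
  by move=> [? ?] _; rewrite mulnC.
rewrite -(pair_big predT predT (fun m k => x (n, k) * x (m, k))) /= exchange_big.
under eq_bigr do rewrite -big_distrr /= colE.
by rewrite -rowE; exact: sum_mulr_leq.
Qed.

Let fwd i j n p q := (p.2 != q.2) * fits (sw_old i j n p q) (sw_new i j n p q) E.
Let bwd i j n p q := (p.2 != q.2) * fits (sw_new i j n p q) (sw_old i j n p q) E.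

(** Only the presence of [(n, i)], [(n, j)], [p] and [q] is kept as a condition. *)
Lemma forward_upper i j : \sum_n \sum_p \sum_q fwd i j n p q <= codeg E i j * S ^ 2.
Proof.
rewrite /codeg big_distrl; apply: leq_sum => n _.
rewrite -mulnn -edgesE big_distrlr big_distrr.
apply: leq_sum => p _ /=; rewrite big_distrr; apply: leq_sum => q _.
rewrite /fwd /fits /x /= !inE /=.
by do 4![case: (_ \in E) => //=]; case: (_ != _); do 4![case: (_ \in E) => //=].
Qed.

(** For a common in-neighbour [n], two edges fail only if one of the four new edges is already
    present or [p.2 = q.2]; each of these five causes spoils at most [d ^ 2 * S] pairs. *)
Lemma forward_lower i j :
  codeg E i j * S ^ 2 <= \sum_n \sum_p \sum_q fwd i j n p q + codeg E i j * (5 * d ^ 2 * S).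
Proof.
pose bad n p q := x p * x (p.1, i) * x q + x p * x (n, p.2) * x q
  + x p * (x q * x (q.1, j)) + x p * (x q * x (n, q.2)) + x p * (x q * (p.2 == q.2)).
have badE n : \sum_p \sum_q bad n p q <= 5 * d ^ 2 * S.
  rewrite /bad.
  under eq_bigr do rewrite !big_split -!big_distrr /= edgesE.
  rewrite !big_split -!big_distrl /= edgesE.
  (* Given [p], at most [d] edges [q] share its head; [S * d] is then weakened to [S * d ^ 2]. *)
  have : \sum_p x p * (\sum_q x q * (p.2 == q.2)) <= S * d.
    rewrite -edgesE; apply: sum_mulr_leq => p.
    rewrite (eq_bigr (fun q => x (q.1, q.2) * (p.2 == q.2))); last by case.
    rewrite -(pair_big predT predT (fun m k => x (m, k) * (p.2 == k))) /= exchange_big.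
    rewrite (bigD1 p.2) //= [X in _ + X]big1 ?addn0.
      by rewrite -big_distrl eqxx /= muln1 colE.
    by move=> k /negbTE kp; rewrite big1 // => ? _; rewrite eq_sym kp muln0.
  have in2 k := leq_mul (leqnn S) (leq_trans (in_path k) (leq_mul (ad k) (leqnn d))).
  have out2 := leq_mul (leqnn S) (leq_trans (out_path n) (leq_mul (bd n) (leqnn d))).
  have dd : S * d <= S * (d * d) by rewrite leq_mul2l; apply/orP; right; case: (d) => //= ?; lia.
  move=> diag; move: (in2 i) (in2 j) out2 dd diag; rewrite -mulnn.
  set u1 := \sum_p _; set u2 := \sum_p _; set u3 := \sum_p _; set u4 := \sum_p _.
  by lia.
rewrite /codeg !big_distrl -big_split; apply: leq_sum => n _ /=.
apply: leq_trans (leq_add (leqnn _) (leq_mul (leqnn _) (badE n))).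
rewrite -mulnn -edgesE big_distrlr big_distrr [in leqRHS]big_distrr -big_split.
apply: leq_sum => p _ /=; rewrite !big_distrr -big_split; apply: leq_sum => q _ /=.
rewrite /fwd /bad /fits /x /= !inE /=.
by case: eqVneq => _ /=; do 8![case: (_ \in E) => //=].
Qed.

(** The factorizing part of the reverse test: the edges of [sw_new] are present. Given [n], there
    are [a i * b n] choices of [p] and [a j * b n] of [q], whence [beta b 2]; equal heads leave a
    single factor [b n], whence [beta b 1]. *)
Let main i j n p q := (x (p.1, i) * x (n, p.2)) * (x (q.1, j) * x (n, q.2)).

Let half i n : \sum_p x (p.1, i) * x (n, p.2) = a i * b n.
Proof.
by rewrite (sum_pair_mul (fun m => x (m, i)) (fun k => x (n, k))) colE rowE.
Qed.

Let main_sum i j : \sum_n \sum_p \sum_q main i j n p q = a i * a j * beta b 2.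
Proof.
rewrite /beta big_distrr; apply: eq_bigr => n _.
by rewrite -big_distrlr /= !half mulnACA mulnn.
Qed.

Let diag_sum i j :
  \sum_n \sum_p \sum_q (p.2 == q.2) * main i j n p q = a i * a j * beta b 1.
Proof.
rewrite /beta big_distrr; apply: eq_bigr => n _.
rewrite (eq_bigr (fun p => a j * (x (p.1, i) * x (n, p.2)))); last first.
  move=> p _; rewrite (eq_bigr (fun q => x (p.1, i) * x (n, p.2) *
    (x (q.1, j) * (p.2 == q.2)))); last first.
    move=> q _; rewrite /main /x; case: eqVneq => [->|_]; rewrite ?muln0 // mul1n muln1.
    by do 3!case: (_ \in E).
  rewrite -big_distrr (sum_pair_mul (fun m => x (m, j)) (fun k => p.2 == k : nat)) colE.
  rewrite (bigD1 p.2) //= eqxx big1 ?addn0 ?muln1 1?mulnC //.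
  by move=> k /negbTE; rewrite eq_sym => ->.
by rewrite -big_distrr /= half expn1 mulnCA mulnA.
Qed.

(** Forgetting that [sw_old] must be absent leaves [main] off the diagonal [p.2 = q.2]. *)
Lemma backward_upper i j :
  \sum_n \sum_p \sum_q bwd i j n p q + a i * a j * beta b 1 <= a i * a j * beta b 2.
Proof.
rewrite -main_sum -diag_sum -big_split; apply: leq_sum => n _ /=.
rewrite -big_split; apply: leq_sum => p _ /=.
rewrite -big_split; apply: leq_sum => q _ /=.
rewrite /bwd /main /fits /x /= !inE /=.
by case: eqVneq => _ /=; do 8![case: (_ \in E) => //=].
Qed.

(** The loss comes from an edge of [sw_old] being present; each of the four costs at most
    [a i * a j * d ^ 3]. *)
Lemma backward_lower i j :
  a i * a j * beta b 2
  <= \sum_n \sum_p \sum_q bwd i j n p q + a i * a j * (beta b 1 + 4 * d ^ 3).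
Proof.
pose bad n p q := x (n, i) * main i j n p q + x (n, j) * main i j n p q
  + (x p * x (p.1, i) * x (n, p.2)) * (x (q.1, j) * x (n, q.2))
  + (x (p.1, i) * x (n, p.2)) * (x q * x (q.1, j) * x (n, q.2)).
(* If [(n, k)] is an edge, [n] has at most [d] values, and [b n ^ 2 <= d ^ 2] bounds the choice of
   the two heads. *)
have bad1 k : \sum_n \sum_p \sum_q x (n, k) * main i j n p q <= a i * a j * d ^ 3.
  apply: (@leq_trans (\sum_n x (n, k) * (a i * a j * d ^ 2))).
    apply: leq_sum => n _; under eq_bigr do rewrite -big_distrr /=.
    rewrite -big_distrr -big_distrlr /= !half leq_mul2l; apply/orP; right.
    by rewrite mulnACA leq_mul2l -mulnn leq_mul ?orbT.
  by rewrite -big_distrl /= colE [d ^ 3]expnSr [leqRHS]mulnA mulnC leq_mul2l ad orbT.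
(* If [p] is an edge, there are at most [a k] choices of [p.1], then [d] of [p.2], then [d] of [n];
   the last [d] bounds [b n]. *)
have bad2 k : \sum_n (\sum_p x p * x (p.1, k) * x (n, p.2)) * b n <= a k * d ^ 3.
  apply: leq_trans (sum_mulr_leq _ bd) _.
  rewrite exchange_big; under eq_bigr do rewrite -big_distrr /= colE; rewrite /=.
  rewrite [d ^ 3]expnSr mulnA leq_mul2r; apply/orP; right.
  apply: leq_trans (sum_mulr_leq _ (fun p => ad p.2)) _.
  by rewrite -mulnn mulnA leq_mul2r in_path orbT.
have badE : \sum_n \sum_p \sum_q bad n p q <= 4 * (a i * a j * d ^ 3).
  have -> : \sum_n \sum_p \sum_q bad n p q =
      \sum_n \sum_p \sum_q x (n, i) * main i j n p q +
      \sum_n \sum_p \sum_q x (n, j) * main i j n p q +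
      a j * (\sum_n (\sum_p x p * x (p.1, i) * x (n, p.2)) * b n) +
      a i * (\sum_n (\sum_p x p * x (p.1, j) * x (n, p.2)) * b n).
    rewrite ![_ * \sum_n (_ * b n)]big_distrr -!big_split; apply: eq_bigr => n _ /=.
    rewrite [a j * _]mulnCA [a i * _]mulnCA -!half [in X in _ + X]mulnC !big_distrlr.
    rewrite -!big_split; apply: eq_bigr => p _ /=.
    by rewrite -!big_split.
  move: (bad1 i) (bad1 j) (leq_mul (leqnn (a j)) (bad2 i)) (leq_mul (leqnn (a i)) (bad2 j)).
  set u1 := \sum_n _; set u2 := \sum_n _; set u3 := \sum_n _; set u4 := \sum_n _.
  by move: (d ^ 3) => ?; lia.
rewrite -main_sum mulnDr -diag_sum addnA mulnCA.
apply: leq_trans (leq_add (leqnn _) badE).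
rewrite -!big_split; apply: leq_sum => n _ /=.
rewrite -!big_split; apply: leq_sum => p _ /=.
rewrite -!big_split; apply: leq_sum => q _ /=.
rewrite /bwd /bad /main /fits /x /= !inE /=.
by case: eqVneq => _ /=; do 8![case: (_ \in E) => //=].
Qed.
End Counts.

End DoubleSwitch.

(** * The mean number of common in-neighbours *)

Section Moments.
Variables (N : nat) (a b : 'I_N -> nat) (d : nat) (i j : 'I_N).
Hypotheses (ad : forall n, a n <= d) (bd : forall n, b n <= d) (ij : i != j).

Let G := digraphs a b.
Let T := \sum_(E in G) codeg E i j.

Let switchings := \sum_(E in G) \sum_n \sum_p \sum_q
  (p.2 != q.2) * fits (sw_old i j n p q) (sw_new i j n p q) E.

(** Double counting: [forward_lower] bounds the switchings from below, [backward_upper] from above.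
    Terms are moved across to avoid truncated subtraction. *)
Lemma codeg_moment_upper :
  T * edges b ^ 2 + #|G| * (a i * a j * beta b 1)
  <= #|G| * (a i * a j * beta b 2) + T * (5 * d ^ 2 * edges b).
Proof.
have fwd : T * edges b ^ 2 <= switchings + T * (5 * d ^ 2 * edges b).
  rewrite /T /switchings !big_distrl -big_split.
  by apply: leq_sum => E EG /=; exact: (forward_lower EG ad bd).
apply: leq_trans (leq_add fwd (leqnn _)) _.
rewrite addnAC leq_add2r /switchings double_switch // -!sum_nat_const -big_split.
by apply: leq_sum => E EG; exact: (backward_upper EG).
Qed.

(** The same double counting with [forward_upper] and [backward_lower]. *)
Lemma codeg_moment_lower :
  #|G| * (a i * a j * beta b 2)
  <= T * edges b ^ 2 + #|G| * (a i * a j * (beta b 1 + 4 * d ^ 3)).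
Proof.
have fwd : switchings <= T * edges b ^ 2.
  rewrite /T /switchings !big_distrl; apply: leq_sum => E EG /=.
  exact: (forward_upper EG).
apply: leq_trans (leq_add fwd (leqnn _)).
rewrite /switchings double_switch // -!sum_nat_const -big_split.
by apply: leq_sum => E EG; exact: (backward_lower EG ad bd).
Qed.

End Moments.

(** * Existence of a graph with given degrees, so that means and ratios have nonzero denominators *)

Section Existence.
Variables (N : nat) (a b : 'I_N -> nat) (d : nat).
Hypotheses (ad : forall n, a n <= d) (bd : forall n, b n <= d).
Implicit Types E : {set 'I_N * 'I_N}.

Let sub E := [forall n, (indeg E n <= a n) && (outdeg E n <= b n)].

Let card_swap E s t : uniq s -> uniq t -> fits s t E ->
  #|swap E s t| + size s = #|E| + size t.
Proof.
move=> us ut fE; have := sum_swap (fun=> 1) us ut fE.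
by rewrite !sum1_card !sum1_size.
Qed.

Let card_indeg E : #|E| = \sum_n indeg E n.
Proof.
rewrite -sum1_card big_mkcond /= (eq_bigr (fun p => (p.1, p.2) \in E : nat)).
  rewrite -(pair_big predT predT (fun m k => (m, k) \in E : nat)) /= exchange_big.
  by apply: eq_bigr => n _; rewrite indeg_sum.
by case=> m k _ /=; case: ifP.
Qed.

Let card_outdeg E : #|E| = \sum_n outdeg E n.
Proof.
rewrite -sum1_card big_mkcond /= (eq_bigr (fun p => (p.1, p.2) \in E : nat)).
  rewrite -(pair_big predT predT (fun m k => (m, k) \in E : nat)) /=.
  by apply: eq_bigr => n _; rewrite outdeg_sum.
by case=> m k _ /=; case: ifP.
Qed.

Let sum_lt (f g : 'I_N -> nat) : \sum_n f n < \sum_n g n -> exists n, f n < g n.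
Proof.
move=> fg; apply/existsP; apply: contraTT fg; rewrite negb_exists => /forallP gf.
by rewrite -leqNgt; apply: leq_sum => n _; rewrite leqNgt.
Qed.

Let sum_eq (f g : 'I_N -> nat) : (forall n, f n <= g n) ->
  \sum_n f n = \sum_n g n -> f =1 g.
Proof.
move=> fg eq n; apply/eqP; rewrite eqn_leq fg leqNgt; apply/negP => lt.
suff : \sum_n f n < \sum_n g n by rewrite eq ltnn.
rewrite (bigD1 n) // [ltnRHS](bigD1 n) //= -addSn leq_add //.
by apply: leq_sum => k _.
Qed.

(* A subgraph with a maximal number of edges realizes the degrees: otherwise
   some row r and column c are deficient, and either (r, c) can be added or some
   edge (m, k) can be replaced by (r, k) and (m, c). *)
Lemma digraphs_nonempty : \sum_n a n = \sum_n b n -> 3 * d ^ 2 < \sum_n b n ->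
  0 < #|digraphs a b|.
Proof.
move=> sab big_S.
have sub0 : sub finset.set0.
  by apply/forallP => n; rewrite indeg_sum outdeg_sum !big1 // => k _; rewrite inE.
case: (@arg_maxnP _ finset.set0 sub (fun E => #|E|) sub0) => E /forallP subE maxE.
have inle n : indeg E n <= a n by have /andP[] := subE n.
have outle n : outdeg E n <= b n by have /andP[] := subE n.
have cardS : #|E| <= \sum_n b n by rewrite card_outdeg; apply: leq_sum.
case: (ltngtP #|E| (\sum_n b n)) cardS => // [ltS|eqS] _; last first.
  apply/card_gt0P; exists E; apply/digraphsP; split; apply: sum_eq => //.
    by rewrite -card_indeg sab.
  by rewrite -card_outdeg.
have [r rdef] : exists n, outdeg E n < b n by apply: sum_lt; rewrite -card_outdeg.
have [c cdef] : exists n, indeg E n < a n by apply: sum_lt; rewrite -card_indeg sab.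
have full v : indeg E v < a v -> (r, v) \in E.
  move=> vdef; apply/negPn/negP => rvE.
  have fE : fits [::] [:: (r, v)] E by rewrite /fits /= inE rvE.
  have := @card_swap E [::] [:: (r, v)] isT isT fE; rewrite /= addn0 addn1 => card1.
  suff /maxE : sub (swap E [::] [:: (r, v)]) by rewrite /= card1 ltnn.
  apply/forallP => n.
  have := @indeg_swap _ [::] [:: (r, v)] E n isT isT fE.
  have := @outdeg_swap _ [::] [:: (r, v)] E n isT isT fE.
  rewrite !big_seq1 !big_nil !addn0 /= => -> ->.
  have := inle n; have := outle n.
  by case: (v =P n) => [?|_]; case: (r =P n) => [?|_]; subst; lia.
(* By [full], the deficient columns are out-neighbours of [r]: there are at most [d], each lacking
   at most [d] edges. *)
have deficit : \sum_n b n <= #|E| + d * d.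
  rewrite -sab card_indeg.
  apply: (@leq_trans (\sum_n (indeg E n + ((r, n) \in E) * d))).
    apply: leq_sum => n _; case: (ltnP (indeg E n) (a n)) => [/full -> | ?].
      by rewrite mul1n; have := ad n; lia.
    by lia.
  rewrite big_split leq_add2l -big_distrl /= -outdeg_sum leq_mul2r.
  by rewrite (leq_trans (outle r)) ?orbT.
have Edeg : E \in digraphs (indeg E) (outdeg E) by apply/digraphsP.
(* At most [d ^ 2] edges end at an out-neighbour of [r], and at most [d ^ 2] start at an
   in-neighbour of [c]. With the deficit this explains the threshold [3 * d ^ 2]. *)
have [[m k] /and3P[mkE rkE mcE]] :
    exists p, [&& p \in E, (r, p.2) \notin E & (p.1, c) \notin E].
  apply/existsP; apply: contraLR big_S; rewrite negb_exists => /forallP none.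
  rewrite -leqNgt.
  have : #|E| <= \sum_p (p \in E) * ((r, p.2) \in E) + \sum_p (p \in E) * ((p.1, c) \in E).
    rewrite -sum1_card big_mkcond -big_split; apply: leq_sum => p _ /=.
    by have := none p; do 3!case: (_ \in E).
  have := in_path Edeg (fun n => leq_trans (outle n) (bd n)) c.
  have := out_path Edeg (fun n => leq_trans (inle n) (ad n)) r.
  have := leq_mul (leq_trans (outle r) (bd r)) (leqnn d).
  have := leq_mul (leq_trans (inle c) (ad c)) (leqnn d).
  move: deficit; rewrite -mulnn; move: (d * d) (indeg E c * d) (outdeg E r * d) => dd u v.
  by move: (\sum_p _) (\sum_p _) (\sum_n _) #|E|; lia.
have fE : fits [:: (m, k)] [:: (r, k); (m, c)] E.
  by rewrite /fits /= !inE mkE rkE mcE.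
have ut : uniq [:: (r, k); (m, c)].
  rewrite /= inE andbT; apply: contraNneq rkE => -[-> _]; exact: mkE.
have := @card_swap E [:: (m, k)] _ isT ut fE; rewrite /= !addnS !addn0 => -[card1].
suff /maxE : sub (swap E [:: (m, k)] [:: (r, k); (m, c)]) by rewrite /= card1 ltnn.
apply/forallP => n.
have := @indeg_swap _ [:: (m, k)] _ E n isT ut fE.
have := @outdeg_swap _ [:: (m, k)] _ E n isT ut fE.
rewrite !big_cons !big_nil /= !addn0 [(k == n) + _]addnC !addnA => /addIn -> /addIn ->.
have := inle n; have := outle n.
by case: (r =P n) => [?|_]; case: (c =P n) => [?|_]; subst; lia.
Qed.

End Existence.

(** * Real estimates for a single bidegree sequence *)

Import Order.TTheory GRing.Theory Num.Theory.
Import numFieldNormedType.Exports.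

Local Open Scope classical_set_scope.
Local Open Scope ring_scope.

Lemma ln_onem_bounds (R : realType) (x : R) : 0 <= x -> x <= 1 / 2 ->
  - x - 2 * x ^+ 2 <= ln (1 - x) <= - x.
Proof.
move=> x0 x2; have x1 : 0 < 1 - x by lra.
apply/andP; split; last by apply: le_ln1Dx; lra.
rewrite -lerN2 -lnV ?posrE //.
(* The lower bound is [ln (1 + y) <= y] at [y = x / (1 - x)], which is at most [x + 2 * x ^+ 2]. *)
have -> : (1 - x)^-1 = 1 + x / (1 - x) by field; rewrite gt_eqF.
apply: le_trans (le_ln1Dx _) _.
  by apply: (@lt_le_trans _ _ 0); [lra|exact: divr_ge0 (ltW x1)].
rewrite ler_pdivrMr // opprD !opprK.
by have : 0 <= x ^+ 2 * (1 - 2 * x); [apply: mulr_ge0; [exact: sqr_ge0|lra]|nra].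
Qed.

Lemma sum_decr (N : nat) (a : 'I_N -> nat) (i : 'I_N) : (0 < a i)%N ->
  (\sum_n decr a i n + 1 = \sum_n a n)%N.
Proof.
move=> ai; have -> : 1%N = (\sum_(n < N) (n == i))%N.
  by rewrite (bigD1 i) //= eqxx big1 // => n /negbTE ->.
rewrite -big_split; apply: eq_bigr => n _ /=.
by rewrite /decr; case: eqP => [->|_]; lia.
Qed.

Lemma decr_leq (N : nat) (a : 'I_N -> nat) (i n : 'I_N) : (decr a i n <= a n)%N.
Proof. exact: leq_subr. Qed.

Section Estimates.
Variables (R : realType) (N : nat) (b : 'I_N -> nat) (d : nat).
Hypothesis bd : forall n, (b n <= d)%N.

Let S : R := (edges b)%:R.
(** The small parameter: the exponent has size [theta], and its error is of order [theta ^+ 2]. *)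
Let theta : R := d%:R ^+ 2 / S.
Hypotheses (S_gt0 : 0 < S) (theta_small : theta <= 1 / 100).

Let eps : R := epsilon R b.

Let beta1E : (beta b 1)%:R = S :> R.
Proof. by rewrite /beta; under eq_bigr do rewrite expn1. Qed.

Let theta_ge0 : 0 <= theta.
Proof. by rewrite divr_ge0 // ?sqr_ge0 // ltW. Qed.

(** From [beta b 1 <= beta b 2 <= d * beta b 1]. *)
Lemma epsilon_bounds : 0 <= eps /\ d%:R * eps <= theta.
Proof.
have le12 : (beta b 1 <= beta b 2)%N.
  by apply: leq_sum => n _; rewrite expn1 -mulnn; nia.
have le2d : (beta b 2 <= d * beta b 1)%N.
  rewrite /beta big_distrr; apply: leq_sum => n _.
  by rewrite expn1 -mulnn leq_mul2r bd orbT.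
rewrite /eps /epsilon beta1E; split.
  by rewrite divr_ge0 ?sqr_ge0 // subr_ge0 -beta1E ler_nat.
rewrite /theta [d%:R ^+ 2]expr2 -mulrA ler_wpM2l // ler_pdivrMr ?exprn_gt0 //.
rewrite expr2 -mulrA mulKf ?gt_eqF // lerBlDr.
apply: (@le_trans _ _ (d%:R * S)); first by rewrite -beta1E -natrM ler_nat.
by rewrite lerDl ltW.
Qed.

(** The moment inequalities divided by [#|G| * a i * S ^ 2]; the mean is taken relative to [a i]
    because [1 - X] is then the factor entering the ratio. *)
Lemma mean_codeg_bounds (a : 'I_N -> nat) (i j : 'I_N) :
  (forall n, (a n <= d)%N) -> i != j -> (0 < a i)%N -> (0 < #|digraphs a b|)%N ->
  let X : R := (\sum_(E in digraphs a b) codeg E i j)%:R / (#|digraphs a b| * a i)%:R in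
  0 <= X /\ (a j)%:R * eps - 4 * theta ^+ 2 <= X <= (a j)%:R * eps + 10 * theta ^+ 2.
Proof.
move=> ad ij ai G0 X; have [eps0 epsd] := epsilon_bounds.
have := codeg_moment_upper ad bd ij; have := codeg_moment_lower ad bd ij.
rewrite /X; move: (\sum_(E in _) _)%N G0 => T; move: #|_| => G G0 lo up.
have Gp : 0 < (G * a i)%:R :> R by rewrite ltr0n muln_gt0 G0.
set x := _ / _.
have TE : T%:R = x * (G%:R * (a i)%:R) by rewrite /x -natrM divfK // gt_eqF.
have x0 : 0 <= x by rewrite divr_ge0.
have d2E : d%:R ^+ 2 = theta * S by rewrite /theta divfK // gt_eqF.
have epsE : (beta b 2)%:R = eps * S ^+ 2 + S.
  by rewrite /eps /epsilon beta1E divfK ?subrK // expf_neq0 // gt_eqF.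
have cancel u v : (G%:R * (a i)%:R * S ^+ 2) * u <= (G%:R * (a i)%:R * S ^+ 2) * v -> u <= v.
  by rewrite ler_pM2l // mulr_gt0 ?exprn_gt0 // -natrM.
have qd : (a j)%:R <= d%:R :> R by rewrite ler_nat.
have {}up : x <= (a j)%:R * eps + x * (5 * theta).
  apply: cancel; move: up; rewrite -(ler_nat R) !(natrD, natrM, natrX) beta1E -/S TE epsE d2E.
  by move=> h; rewrite -subr_ge0; move: h; rewrite -subr_ge0; congr (0 <= _); ring.
(* The error [4 * a j * d ^ 3 / S ^ 2] is at most [4 * d ^ 4 / S ^ 2]. *)
have {}lo : (a j)%:R * eps <= x + 4 * theta ^+ 2.
  apply: (@le_trans _ _ (x + 4 * ((a j)%:R * d%:R * (theta / S)))).
    apply: cancel; move: lo; rewrite -(ler_nat R) !(natrD, natrM, natrX) beta1E -/S TE epsE.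
    rewrite (exprS _ 2) d2E.
    move=> h; rewrite -subr_ge0; move: h; rewrite -subr_ge0; congr (0 <= _).
    by field; rewrite gt_eqF.
  rewrite lerD2l ler_pM2l // expr2 {3}/theta mulrC -mulrA ler_wpM2l //.
  by rewrite mulrC ler_wpM2r ?invr_ge0 ?(ltW S_gt0) // expr2 ler_wpM2r.
have qeps : (a j)%:R * eps <= theta by apply: le_trans epsd; rewrite ler_wpM2r.
(* As [5 * theta <= 1 / 2], the upper bound gives [x <= 2 * theta], so its error [5 * theta * x] is
   at most [10 * theta ^+ 2]. *)
have xt : x * (5 * theta) <= x * (1 / 2) by rewrite ler_wpM2l //; have := theta_small; lra.
have x2 : theta * x <= theta * (2 * theta) by rewrite ler_wpM2l //; lra.
by split=> //; apply/andP; split; rewrite expr2; lra.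
Qed.

Lemma ratio_estimate (a : 'I_N -> nat) (i j : 'I_N) :
  (forall n, (a n <= d)%N) -> (\sum_n a n = \sum_n b n + 1)%N ->
  (0 < a i)%N -> (0 < a j)%N ->
  (exists2 delta : R, `|delta| <= 22 * theta ^+ 2 &
     #|digraphs (decr a i) b|%:R / #|digraphs (decr a j) b|%:R
     = (a i)%:R / (a j)%:R * expR (((a i)%:R - (a j)%:R) * eps + delta))
  /\ `|((a i)%:R - (a j)%:R) * eps| <= theta.
Proof.
move=> ad sab ai aj; have [eps0 epsd] := epsilon_bounds.
have ded k n : (decr a k n <= d)%N := leq_trans (decr_leq a k n) (ad n).
(* Lowering one in-degree balances the two sums, and [theta <= 1 / 100] gives [3 * d ^ 2 < S]. *)
have pos k : (0 < a k)%N -> (0 < #|digraphs (decr a k) b|)%N.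
  move=> ak; apply: (@digraphs_nonempty _ _ _ d) => //.
    by have := sum_decr ak; rewrite sab => /addIn.
  rewrite -(ltr_nat R) natrM natrX -/(edges b) -/S.
  by have := theta_small; rewrite /theta ler_pdivrMr //; have := S_gt0; lra.
have iR : (a i)%:R <= d%:R :> R by rewrite ler_nat.
have jR : (a j)%:R <= d%:R :> R by rewrite ler_nat.
have i0 : 0 < (a i)%:R :> R by rewrite ltr0n.
have j0 : 0 < (a j)%:R :> R by rewrite ltr0n.
split; last first.
  rewrite normrM (ger0_norm eps0); apply: le_trans epsd; rewrite ler_wpM2r //.
  by rewrite ler_norml; apply/andP; split; lra.
(* Switchings need [i != j]; for [i = j] the ratio is 1 and [delta = 0]. *)
case: (eqVneq i j) => [->|ij].
  exists 0; first by rewrite normr0 mulr_ge0 // sqr_ge0.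
  by rewrite subrr mul0r addr0 expR0 mulr1 !divff // gt_eqF // ltr0n pos.
have [ji] : j != i by rewrite eq_sym.
have aji : decr a j i = a i by rewrite /decr (negbTE ij) subn0.
have aij : decr a i j = a j by rewrite /decr (negbTE ji) subn0.
(* The means have main terms [(a j - 1) * eps] for [X] and [(a i - 1) * eps] for [Y]; the two shifts
   by one cancel in [Y - X]. *)
have ajj : (decr a j j)%:R = (a j)%:R - 1 :> R by rewrite /decr eqxx natrB.
have aii : (decr a i i)%:R = (a i)%:R - 1 :> R by rewrite /decr eqxx natrB.
have := mean_codeg_bounds (ded j) ij; rewrite aji => /(_ ai (pos j aj)).
have := mean_codeg_bounds (ded i) ji; rewrite aij => /(_ aj (pos i ai)).
have codegC : (\sum_(E in digraphs (decr a i) b) codeg E j i =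
    \sum_(E in digraphs (decr a i) b) codeg E i j)%N.
  by apply: eq_bigr => E _; apply: eq_bigr => n _; rewrite mulnC.
have := sum_codeg_move b ij ai aj; rewrite codegC ajj aii.
move: (pos i ai) (pos j aj).
move: (\sum_(E in digraphs (decr a i) b) _)%N (\sum_(E in digraphs (decr a j) b) _)%N.
move: #|digraphs (decr a i) b| #|digraphs (decr a j) b| => B A TB TA B0 A0 moves /=.
have B0' : 0 < B%:R :> R by rewrite ltr0n.
have A0' : 0 < A%:R :> R by rewrite ltr0n.
rewrite !natrM; set Y := TB%:R / _; set X := TA%:R / _.
move=> [Y0 /andP[Ylo Yup]] [X0 /andP[Xlo Xup]].
have movesR : A%:R * (a i)%:R * (1 - X) = B%:R * (a j)%:R * (1 - Y).
  have TBE : TB%:R = Y * (B%:R * (a j)%:R) by rewrite /Y divfK // mulf_neq0 // gt_eqF.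
  have TAE : TA%:R = X * (A%:R * (a i)%:R) by rewrite /X divfK // mulf_neq0 // gt_eqF.
  by have := congr1 (fun k => k%:R : R) moves; rewrite !natrD !natrM TAE TBE; lra.
have t2 : theta ^+ 2 <= theta / 100.
  by rewrite expr2 ler_wpM2l //; have := theta_small; lra.
have ie : (a i)%:R * eps <= theta by apply: le_trans epsd; rewrite ler_wpM2r.
have je : (a j)%:R * eps <= theta by apply: le_trans epsd; rewrite ler_wpM2r.
have X2 : X <= 2 * theta by lra.
have Y2 : Y <= 2 * theta by lra.
have Xs : X ^+ 2 <= 4 * theta ^+ 2 by nra.
have Ys : Y ^+ 2 <= 4 * theta ^+ 2 by nra.
have /andP[lXlo lXup] : - X - 2 * X ^+ 2 <= ln (1 - X) <= - X.
  by apply: ln_onem_bounds => //; have := theta_small; lra.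
have /andP[lYlo lYup] : - Y - 2 * Y ^+ 2 <= ln (1 - Y) <= - Y.
  by apply: ln_onem_bounds => //; have := theta_small; lra.
(* The constant is 22 = 10 + 4 + 8: opposite bounds on [X] and [Y] give 10 and 4, the quadratic term
   of one logarithm gives 8. *)
exists (ln (1 - X) - ln (1 - Y) - ((a i)%:R - (a j)%:R) * eps).
  by rewrite ler_norml; apply/andP; split; lra.
rewrite [_ * eps + _]addrC subrK expRB !lnK ?posrE; try (have := theta_small; lra).
have Y1 : 1 - Y != 0 by rewrite gt_eqF //; have := theta_small; lra.
apply: (@mulIf _ (A%:R * (a j)%:R * (1 - Y))); first by rewrite !mulf_neq0 // gt_eqF.
transitivity (B%:R * (a j)%:R * (1 - Y)); first by field; rewrite gt_eqF.
by rewrite -movesR; field; rewrite Y1 gt_eqF.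
Qed.

End Estimates.

(** * Asymptotics along the sequence *)

Lemma maxdeg_leq (N : nat) (a b : 'I_N -> nat) n :
  (a n <= maxdeg a b)%N /\ (b n <= maxdeg a b)%N.
Proof.
have := @leq_bigmax _ (fun n => maxn (a n) (b n)) n; rewrite geq_max => /andP[].
by split.
Qed.

Lemma near_powR_large (R : realType) (tau k : R) (S : nat -> nat) :
  0 < tau -> 0 <= k -> S t @[t --> \oo] --> \oo ->
  \forall t \near \oo, 0 < (S t)%:R :> R /\ k <= (S t)%:R `^ tau.
Proof.
(* It suffices that [S t] exceed [k] to the power [1 / tau]; the successor also makes it
   positive. *)
move=> tau0 k0 /cvgnyPge/(_ (Num.bound (k `^ tau^-1)).+1).
apply: filterS => t St; split; first by rewrite ltr0n (leq_trans _ St).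
have -> : k = (k `^ tau^-1) `^ tau by rewrite -powRrM mulVf ?powRr1 // lt0r_neq0.
apply: ge0_ler_powR; rewrite ?nnegrE ?powR_ge0 ?ler0n ?(ltW tau0) //.
by apply: le_trans (ltW (archi_boundP (powR_ge0 _ _))) _; rewrite ler_nat ltnW.
Qed.

Theorem theorem6 (R : realType) (tau : R) (N : nat -> nat)
    (a b : forall t : nat, 'I_(N t) -> nat) :
  0 < tau ->
  (forall t, \sum_(n < N t) a t n = \sum_(n < N t) b t n + 1)%N ->
  edges (b t) @[t --> \oo] --> \oo ->
  (fun t => (maxdeg (a t) (b t))%:R : R^o) =O_\oo
    (fun t => (edges (b t))%:R `^ (1 / 2 - tau) : R^o) ->
  exists C : R, \forall t \near \oo, forall i j : 'I_(N t),
    (1 <= a t i)%N -> (1 <= a t j)%N ->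
    (exists2 delta : R, `|delta| <= C * (edges (b t))%:R `^ (- (4 * tau)) &
       #|digraphs (decr (a t) i) (b t)|%:R / #|digraphs (decr (a t) j) (b t)|%:R
       = (a t i)%:R / (a t j)%:R
         * expR (((a t i)%:R - (a t j)%:R) * epsilon R (b t) + delta))
    /\ `|((a t i)%:R - (a t j)%:R) * epsilon R (b t)|
         <= C * (edges (b t))%:R `^ (- (2 * tau)).
Proof.
move=> tau0 sab Soo /eqO_exP[k k0 kO].
(* One constant for both bounds: [theta] is at most [k ^+ 2] times the power [- (2 * tau)] of [S],
   and [delta] is at most [22 * theta ^+ 2]. *)
exists (22 * k ^+ 4 + k ^+ 2).
have tau2 : 0 < 2 * tau by rewrite mulr_gt0.
have large := near_powR_large tau2 (mulr_ge0 (ler0n R 100) (sqr_ge0 k)) Soo.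
(* The threshold on [t] is fixed before [i] and [j], which gives uniformity in the indices. *)
near=> t => i j ai aj.
have [S0 Sk] : 0 < (edges (b t))%:R :> R /\ 100 * k ^+ 2 <= (edges (b t))%:R `^ (2 * tau).
  by near: t; exact: large.
have dk : (maxdeg (a t) (b t))%:R <= k * (edges (b t))%:R `^ (1 / 2 - tau) :> R.
  rewrite -[leLHS]ger0_norm ?ler0n // -[X in _ * X]ger0_norm ?powR_ge0 //.
  by near: t; exact: kO.
set S : R := (edges (b t))%:R in S0 Sk dk *; set d := maxdeg _ _ in dk.
set theta : R := d%:R ^+ 2 / S.
have S2 : (S `^ (1 / 2 - tau)) ^+ 2 = S * S `^ (- (2 * tau)).
  rewrite -powR_mulrn ?powR_ge0 // -powRrM.
  have -> : (1 / 2 - tau) * 2%:R = 1 + - (2 * tau) by field.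
  by rewrite powRD ?lt0r_neq0 ?implybT // powRr1 // ltW.
have S4 : S `^ (- (4 * tau)) = (S `^ (- (2 * tau))) ^+ 2.
  rewrite -[RHS]powR_mulrn ?powR_ge0 // -powRrM; congr (_ `^ _); ring.
have theta_ge0 : 0 <= theta by rewrite divr_ge0 ?sqr_ge0 // ltW.
have theta_le : theta <= k ^+ 2 * S `^ (- (2 * tau)).
  rewrite ler_pdivrMr // -mulrA [_ * S]mulrC -S2 -exprMn.
  by rewrite ler_sqr ?nnegrE // mulr_ge0 ?powR_ge0 // ltW.
have theta_small : theta <= 1 / 100.
  apply: le_trans theta_le _; rewrite powRN ler_pdivrMr ?powR_gt0 //.
  by move: Sk; lra.
have [] := @ratio_estimate R _ (b t) d _ S0 theta_small (a t) i j _ (sab t) ai aj.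
- by move=> n; case: (maxdeg_leq (a t) (b t) n).
- by move=> n; case: (maxdeg_leq (a t) (b t) n).
move=> [delta dle ratio] le1; split.
  exists delta => //; apply: le_trans dle _; rewrite S4.
  apply: (@le_trans _ _ (22 * (k ^+ 2 * S `^ (- (2 * tau))) ^+ 2)).
    by rewrite ler_pM2l // ler_sqr ?nnegrE // (le_trans theta_ge0).
  rewrite exprMn -exprM mulrA ler_wpM2r ?sqr_ge0 //.
  by rewrite lerDl sqr_ge0.
apply: le_trans le1 _; apply: le_trans theta_le _.
by rewrite ler_wpM2r ?powR_ge0 // lerDr mulr_ge0 // exprn_ge0 // ltW.
Unshelve. all: by end_near.
Qed.
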